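(* For every integer $m\ge 2$ let $$E(m)=\frac{m\,(2m-1)!}{(2m+1)\,2^{2m-2}\,(m!)^2}-\frac{2m\cdot 2^{2m-2}\,((m-1)!)^2}{(2m+1)!}.$$ Then for every integer $n\ge 2$ and every $x\in(0,1)$, $$\frac{\sum_{m=2}^{n}E(m)x^{2m+1}}{2+\sqrt{1-x^2}}<\arcsin x-\frac{3x}{2+\sqrt{1-x^2}}<\frac{\sum_{m=2}^{n-1}E(m)x^{2m+1}+\left(\pi-3-\sum_{m=2}^{n-1}E(m)\right)x^{2n+1}}{2+\sqrt{1-x^2}}.$$
   Context: An empty sum (such as $\sum_{m=2}^{n-1}$ when $n=2$) equals $0$. *)

(* Defs.v *)
From Stdlib Require Import Reals Factorial.
From Coquelicot Require Import Coquelicot.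
Open Scope R_scope.

(* Only meant for m >= 2, where the truncated subtractions on nat are exact. *)
Definition E (m : nat) : R :=
  (INR m * INR (fact (2 * m - 1)))
    / ((2 * INR m + 1) * 2 ^ (2 * m - 2) * INR (fact m) ^ 2)
  - (2 * INR m * 2 ^ (2 * m - 2) * INR (fact (m - 1)) ^ 2)
    / INR (fact (2 * m + 1)).

(* Main.v *)
Require Import Defs.
From Stdlib Require Import Reals Factorial Lra Lia.
From Coquelicot Require Import Coquelicot.
Open Scope R_scope.

(** The inequality is a statement about the Maclaurin series of
    [f x = (2 + sqrt (1 - x^2)) * asin x - 3 * x].

    The two terms of [E m] are the coefficients of [x^(2m+1)] in [2 * asin x]
    and in [- sqrt (1 - x^2) * asin x], and the terms in [x] and [x^3] cancel, so
    that [f x] is the sum of the [E m * x^(2m+1)] over [m >= 2].  Convergence is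
    proved by explicit remainder bounds ([asin_remainder], [sqrt_asin_remainder]):
    each partial sum satisfies the first-order linear differential equation of
    the function that it approximates up to a single monomial, so that the
    remainder, multiplied by an integrating factor, has a derivative of the order
    of its last power of [x].

    Every [E m] with [m >= 2] is positive ([E_pos]), because [E 2 = 1/60] and the
    coefficients of [2 * asin] decrease more slowly than those subtracted from
    them.  The lower bound is then the fact that partial sums increase strictly
    to [f x].

    For the upper bound, [partial_sum 1 N <= PI - 3] ([partial_sum_at_1_le]), by
    letting [y] tend to [1] in [partial_sum y N <= f y].  In the tail
    from [m = n] on, [x^(2m+1) <= x^(2n+1)], so that the tail is at most
    [x^(2n+1)] times the tail at [1], which is at most
    [PI - 3 - partial_sum 1 (n-1)].  The term [m = n + 1] alone makes the
    inequality strict ([tail_compare]). *)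

(** * The coefficients *)

Definition partial_sum (x : R) (N : nat) : R :=
  sum_n_m (fun m => E m * x ^ (2 * m + 1)) 2 N.

Definition inv_sqrt_coef (m : nat) : R :=
  INR (fact (2 * m)) / (4 ^ m * INR (fact m) ^ 2).

(** The function [x - sqrt (1 - x^2) * asin x] has these coefficients at
    [x^(2m+1)].  The factor [INR m] makes the value at [0] vanish, so that sums
    over this family may start at [0]. *)
Definition sqrt_asin_coef (m : nat) : R :=
  2 * INR m * 2 ^ (2 * m - 2) * INR (fact (m - 1)) ^ 2 / INR (fact (2 * m + 1)).

Lemma INR_fact_S (n : nat) : INR (fact (S n)) = (INR n + 1) * INR (fact n).
Proof. now rewrite fact_simpl, mult_INR, S_INR. Qed.

Lemma pow2_double (k : nat) : 2 ^ (2 * k) = 4 ^ k.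
Proof. rewrite pow_mult; f_equal; ring. Qed.

Lemma inv_sqrt_coef_0 : inv_sqrt_coef 0 = 1.
Proof. unfold inv_sqrt_coef; simpl; field. Qed.

Lemma inv_sqrt_coef_S (m : nat) :
  inv_sqrt_coef (S m) = (2 * INR m + 1) / (2 * INR m + 2) * inv_sqrt_coef m.
Proof.
  unfold inv_sqrt_coef.
  replace (2 * S m)%nat with (S (S (2 * m))) by lia.
  rewrite !INR_fact_S, S_INR, mult_INR; simpl (INR 2); rewrite <- tech_pow_Rmult.
  assert (0 < 4 ^ m) by (apply pow_lt; lra).
  pose proof (INR_fact_lt_0 m); pose proof (pos_INR m).
  field; repeat split; lra.
Qed.

Lemma sqrt_asin_coef_0 : sqrt_asin_coef 0 = 0.
Proof. unfold sqrt_asin_coef; simpl; field. Qed.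

Lemma sqrt_asin_coef_1 : sqrt_asin_coef 1 = 1 / 3.
Proof. unfold sqrt_asin_coef; simpl; field. Qed.

Lemma sqrt_asin_coef_SS (k : nat) :
  sqrt_asin_coef (S (S k))
  = (2 * INR k + 2) / (2 * INR k + 5) * sqrt_asin_coef (S k).
Proof.
  unfold sqrt_asin_coef.
  replace (2 * S (S k) + 1)%nat with (S (S (2 * S k + 1))) by lia.
  replace (2 * S (S k) - 2)%nat with (2 * S k)%nat by lia.
  replace (2 * S k - 2)%nat with (2 * k)%nat by lia.
  replace (S (S k) - 1)%nat with (S k) by lia.
  replace (S k - 1)%nat with k by lia.
  rewrite (INR_fact_S (S _)), (INR_fact_S (2 * S k + 1)), (INR_fact_S k).
  rewrite !pow2_double, <- tech_pow_Rmult.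
  rewrite !S_INR, plus_INR, mult_INR; simpl (INR 2); simpl (INR 1); rewrite S_INR.
  pose proof (INR_fact_lt_0 (2 * S k + 1)); pose proof (pos_INR k).
  field; repeat split; lra.
Qed.

Lemma E_coef (k : nat) :
  E (S k) = 2 * (inv_sqrt_coef (S k) / (2 * INR (S k) + 1)) - sqrt_asin_coef (S k).
Proof.
  unfold E, sqrt_asin_coef, inv_sqrt_coef; f_equal.
  replace (2 * S k - 1)%nat with (S (2 * k)) by lia.
  replace (2 * S k)%nat with (S (S (2 * k))) by lia.
  replace (S (S (2 * k)) - 2)%nat with (2 * k)%nat by lia.
  rewrite (INR_fact_S (S (2 * k))), pow2_double, <- (tech_pow_Rmult 4).
  rewrite !S_INR, mult_INR; simpl (INR 2).
  assert (0 < 4 ^ k) by (apply pow_lt; lra).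
  pose proof (INR_fact_lt_0 (S k)); pose proof (pos_INR k).
  field; repeat split; lra.
Qed.

Lemma inv_sqrt_coef_bounds (m : nat) : 0 < inv_sqrt_coef m <= 1.
Proof.
  induction m as [|m IH].
  - rewrite inv_sqrt_coef_0; lra.
  - rewrite inv_sqrt_coef_S; pose proof (pos_INR m).
    assert (0 < (2 * INR m + 1) / (2 * INR m + 2)) by (apply Rdiv_lt_0_compat; lra).
    assert ((2 * INR m + 1) / (2 * INR m + 2) < 1) by (apply Rcomplements.Rlt_div_l; lra).
    nra.
Qed.

Lemma sqrt_asin_coef_bounds (k : nat) : 0 < sqrt_asin_coef (S k) <= 1.
Proof.
  induction k as [|k IH].
  - rewrite sqrt_asin_coef_1; lra.
  - rewrite sqrt_asin_coef_SS; pose proof (pos_INR k).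
    assert (0 < (2 * INR k + 2) / (2 * INR k + 5)) by (apply Rdiv_lt_0_compat; lra).
    assert ((2 * INR k + 2) / (2 * INR k + 5) < 1) by (apply Rcomplements.Rlt_div_l; lra).
    nra.
Qed.

(** Passing from [m] to [m + 1] multiplies the [2 * asin] term of [E] by
    [(2m+1)^2 / ((2m+2)(2m+3))] and the other one by
    [4m(m+1) / ((2m+2)(2m+3))], which is smaller. *)
Lemma E_pos (m : nat) : (2 <= m)%nat -> 0 < E m.
Proof.
  induction 1 as [|m Hm IH].
  - unfold E; simpl; lra.
  - destruct m as [|k]; [lia|].
    rewrite E_coef in *; rewrite sqrt_asin_coef_SS, (inv_sqrt_coef_S (S k)).
    pose proof (inv_sqrt_coef_bounds (S k)); pose proof (pos_INR k).
    rewrite !S_INR in *.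
    set (z := INR k) in *; set (b := sqrt_asin_coef (S k)) in *.
    set (c := inv_sqrt_coef (S k)) in *.
    (* The new value is the old one times the ratio of the subtracted
       coefficients, plus the gain from the larger ratio of the others. *)
    match goal with |- 0 < ?e => replace e
      with ((2 * z + 2) / (2 * z + 5) * (2 * (c / (2 * (z + 1) + 1)) - b)
            + 2 * c / ((2 * z + 3) * (2 * z + 4) * (2 * z + 5)))
        by (field; lra)
    end.
    apply Rplus_lt_0_compat.
    + apply Rmult_lt_0_compat; [apply Rdiv_lt_0_compat|]; lra.
    + apply Rdiv_lt_0_compat; [lra|].
      repeat apply Rmult_lt_0_compat; lra.
Qed.

(** * Partial sums of the three series *)

Definition inv_sqrt_poly (N : nat) (x : R) : R :=
  sum_f_R0 (fun m => inv_sqrt_coef m * x ^ (2 * m)) N.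

Definition asin_poly (N : nat) (x : R) : R :=
  sum_f_R0 (fun m => inv_sqrt_coef m / (2 * INR m + 1) * x ^ (2 * m + 1)) N.

Definition sqrt_asin_poly (N : nat) (x : R) : R :=
  x - sum_f_R0 (fun m => sqrt_asin_coef m * x ^ (2 * m + 1)) N.

Lemma is_derive_monomial (a : R) (n : nat) (x : R) :
  is_derive (fun y => a * y ^ S n) x (a * (INR n + 1) * x ^ n).
Proof.
  auto_derive; [easy|].
  change (a * (1 * (INR (S n) * x ^ n)) = a * (INR n + 1) * x ^ n).
  rewrite S_INR; ring.
Qed.

Lemma is_derive_asin_poly (N : nat) (x : R) :
  is_derive (asin_poly N) x (inv_sqrt_poly N x).
Proof.
  unfold asin_poly, inv_sqrt_poly.
  induction N as [|N IH]; cbn [sum_f_R0].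
  - auto_derive; [easy|]. simpl; field.
  - apply (is_derive_plus (V := R_NormedModule)); [exact IH|].
    replace (2 * S N + 1)%nat with (S (2 * S N)) by lia.
    assert (Hd : 2 * INR (S N) + 1 <> 0) by (pose proof (pos_INR (S N)); lra).
    evar_last; [apply is_derive_monomial|].
    rewrite mult_INR; simpl (INR 2); field; exact Hd.
Qed.

(** [y = 1 / sqrt (1 - x^2)] solves [(1 - x^2) y' = x y]; its partial sum solves
    it up to the one monomial that the recurrence for the coefficients does not
    cancel. *)
Lemma is_derive_inv_sqrt_poly (N : nat) (x : R) : 1 - x ^ 2 <> 0 ->
  is_derive (inv_sqrt_poly N) x
    ((x * inv_sqrt_poly N x
      - (2 * INR N + 1) * inv_sqrt_coef N * x ^ (2 * N + 1)) / (1 - x ^ 2)).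
Proof.
  intros Hx; unfold inv_sqrt_poly.
  induction N as [|N IH]; cbn [sum_f_R0].
  - auto_derive; [easy|]. rewrite inv_sqrt_coef_0; simpl; field.
    contradict Hx; rewrite <- Hx; ring.
  - replace (2 * S N)%nat with (S (2 * N + 1)) by lia.
    evar_last.
    + apply (is_derive_plus (V := R_NormedModule)); [exact IH|].
      apply is_derive_monomial.
    + match goal with |- plus ?a ?b = ?c => change (@eq R (Rplus a b) c) end.
      replace (S (2 * N + 1) + 1)%nat with (S (S (2 * N + 1))) by lia.
      rewrite inv_sqrt_coef_S, plus_INR, mult_INR, (S_INR N).
      replace (INR 2) with 2 by (simpl; ring); replace (INR 1) with 1 by reflexivity.
      rewrite <- (tech_pow_Rmult x (S (2 * N + 1))), <- !(tech_pow_Rmult x (2 * N + 1)).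
      pose proof (pos_INR N); field; split; lra.
Qed.

(** The analogue for [y = sqrt (1 - x^2) * asin x], which solves
    [(1 - x^2) y' + x y = 1 - x^2].  The term [- x^2] of the right-hand side is
    matched by the coefficient of [x^3], whence the degree at least [3]. *)
Lemma is_derive_sqrt_asin_poly (k : nat) (x : R) : 1 - x ^ 2 <> 0 ->
  is_derive (sqrt_asin_poly (S k)) x
    ((1 - x ^ 2 - x * sqrt_asin_poly (S k) x
      + (2 * INR k + 2) * sqrt_asin_coef (S k) * x ^ (2 * k + 4)) / (1 - x ^ 2)).
Proof.
  intros Hx; induction k as [|k IH].
  - unfold sqrt_asin_poly; cbn [sum_f_R0].
    rewrite sqrt_asin_coef_0, sqrt_asin_coef_1.
    auto_derive; [easy|]. simpl; field.
    contradict Hx; rewrite <- Hx; ring.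
  - apply (is_derive_ext
      (fun y => sqrt_asin_poly (S k) y
                + - sqrt_asin_coef (S (S k)) * y ^ S (2 * k + 4))).
    { intros y; unfold sqrt_asin_poly.
      replace (S (2 * k + 4)) with (2 * S (S k) + 1)%nat by lia.
      rewrite (tech5 _ (S k)).
      match goal with |- ?a = ?b => change (@eq R a b) end; ring. }
    evar_last.
    + apply (is_derive_plus (V := R_NormedModule)); [exact IH|].
      apply is_derive_monomial.
    + match goal with |- plus ?a ?b = ?c => change (@eq R (Rplus a b) c) end.
      replace (sqrt_asin_poly (S (S k)) x) with
        (sqrt_asin_poly (S k) x - sqrt_asin_coef (S (S k)) * x ^ S (2 * k + 4)).
      2:{ unfold sqrt_asin_poly.
          replace (S (2 * k + 4)) with (2 * S (S k) + 1)%nat by lia.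
          rewrite (tech5 _ (S k)); ring. }
      replace (2 * S k + 4)%nat with (S (S (2 * k + 4))) by lia.
      rewrite sqrt_asin_coef_SS, plus_INR, mult_INR, (S_INR k).
      replace (INR 2) with 2 by (simpl; ring); replace (INR 4) with 4 by (simpl; ring).
      rewrite <- (tech_pow_Rmult x (S (2 * k + 4))), <- !(tech_pow_Rmult x (2 * k + 4)).
      pose proof (pos_INR k); field; split; lra.
Qed.

(** * Remainder estimates *)

Lemma le_of_derive_nonneg (F dF : R -> R) (x : R) :
  0 <= x ->
  (forall t, 0 <= t <= x -> is_derive F t (dF t)) ->
  (forall t, 0 <= t <= x -> 0 <= dF t) ->
  F 0 <= F x.
Proof.
  intros Hx HF Hp.
  destruct (MVT_gen F 0 x dF) as [c [Hc Heq]];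
    rewrite ?Rmin_left, ?Rmax_right in * by lra.
  - intros t Ht; apply HF; lra.
  - intros t Ht; apply continuity_pt_filterlim.
    apply (ex_derive_continuous (V := R_NormedModule)).
    eexists; apply HF; lra.
  - specialize (Hp c Hc); nra.
Qed.

Lemma Rabs_le_of_derive (F dF G dG : R -> R) (x : R) :
  0 <= x -> F 0 = 0 -> G 0 = 0 ->
  (forall t, 0 <= t <= x -> is_derive F t (dF t)) ->
  (forall t, 0 <= t <= x -> is_derive G t (dG t)) ->
  (forall t, 0 <= t <= x -> Rabs (dF t) <= dG t) ->
  Rabs (F x) <= G x.
Proof.
  intros Hx HF0 HG0 HF HG Hle.
  assert (H1 := le_of_derive_nonneg (fun t => G t - F t) (fun t => dG t - dF t) x Hx).
  assert (H2 := le_of_derive_nonneg (fun t => G t + F t) (fun t => dG t + dF t) x Hx).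
  cbv beta in H1, H2; rewrite HF0, HG0 in H1, H2.
  apply Rabs_le; split.
  - enough (0 + 0 <= G x + F x) by lra. apply H2; intros t Ht.
    + apply (is_derive_plus (V := R_NormedModule)); auto.
    + specialize (Hle t Ht). pose proof (Rcomplements.Rabs_le_between (dF t) (dG t)). lra.
  - enough (0 - 0 <= G x - F x) by lra. apply H1; intros t Ht.
    + apply (is_derive_minus (V := R_NormedModule)); auto.
    + specialize (Hle t Ht). pose proof (Rcomplements.Rabs_le_between (dF t) (dG t)). lra.
Qed.

Lemma is_derive_asin (x : R) : -1 < x < 1 ->
  is_derive asin x (/ sqrt (1 - x ^ 2)).
Proof.
  intros Hx; apply is_derive_Reals.
  replace (/ sqrt (1 - x ^ 2)) with (derive_pt asin x (derivable_pt_asin x Hx)).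
  - apply (derive_pt_eq_1 _ _ _ (derivable_pt_asin x Hx)); reflexivity.
  - rewrite derive_pt_asin; unfold Rdiv, Rsqr.
    rewrite Rmult_1_l; do 2 f_equal; ring.
Qed.

Section Remainders.

Variable x : R.
Hypothesis Hx : 0 < x < 1.

Let w := sqrt (1 - x ^ 2).

Lemma w_bounds : 0 < w <= 1.
Proof.
  split; [apply sqrt_lt_R0; nra|].
  rewrite <- sqrt_1; apply sqrt_le_1_alt; nra.
Qed.

Lemma sqrt_ge_w (t : R) : 0 <= t <= x ->
  w <= sqrt (1 - t ^ 2) <= 1 /\ sqrt (1 - t ^ 2) ^ 2 = 1 - t ^ 2.
Proof.
  intros Ht; repeat split.
  - apply sqrt_le_1_alt; nra.
  - apply Rle_trans with (sqrt 1); [apply sqrt_le_1_alt; nra|rewrite sqrt_1; lra].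
  - rewrite pow2_sqrt; nra.
Qed.

Lemma is_derive_sqrt_one_minus_sq (t : R) : 0 <= t <= x ->
  is_derive (fun y => sqrt (1 - y ^ 2)) t (- t / sqrt (1 - t ^ 2)).
Proof.
  intros Ht; pose proof w_bounds; destruct (sqrt_ge_w t Ht) as [[H1 _] H2].
  auto_derive.
  - simpl in *; nra.
  - change (1 + - (t * (t * 1))) with (1 - t ^ 2); simpl INR; field; lra.
Qed.

(** With [P] the partial sum of [1 / sqrt (1 - x^2)], the function
    [1 - sqrt (1 - x^2) * P] has a single monomial divided by [sqrt (1 - x^2)] as
    derivative.  Its coefficient is at most [2N + 2], which the derivative of
    [t^(2N+2)] absorbs, so that no factor growing with [N] is left. *)
Lemma inv_sqrt_remainder (N : nat) (t : R) : 0 <= t <= x ->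
  Rabs (1 - sqrt (1 - t ^ 2) * inv_sqrt_poly N t) <= / w * t ^ (2 * N + 2).
Proof.
  intros Ht; pose proof w_bounds as Hw.
  apply (Rabs_le_of_derive
    (fun y => 1 - sqrt (1 - y ^ 2) * inv_sqrt_poly N y)
    (fun y => (2 * INR N + 1) * inv_sqrt_coef N * y ^ (2 * N + 1) / sqrt (1 - y ^ 2))
    (fun y => / w * y ^ (2 * N + 2))
    (fun y => / w * (2 * INR N + 2) * y ^ (2 * N + 1))).
  - lra.
  - replace (inv_sqrt_poly N 0) with 1.
    + replace (1 - 0 ^ 2) with 1 by ring; rewrite sqrt_1; ring.
    + unfold inv_sqrt_poly; induction N as [|N IH]; cbn [sum_f_R0].
      * rewrite inv_sqrt_coef_0; simpl; ring.
      * rewrite <- IH; replace (N + S (N + 0))%nat with (S (2 * N)) by lia.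
        simpl; ring.
  - rewrite pow_i by lia; ring.
  - intros y Hy; assert (Hy' : 0 <= y <= x) by lra.
    destruct (sqrt_ge_w y Hy') as [H1 H2].
    evar_last.
    + apply (is_derive_minus (V := R_NormedModule)).
      * apply (is_derive_const (V := R_NormedModule)).
      * apply (is_derive_mult (fun y => sqrt (1 - y ^ 2))).
        -- apply is_derive_sqrt_one_minus_sq; exact Hy'.
        -- apply is_derive_inv_sqrt_poly; nra.
        -- intros; apply Rmult_comm.
    + match goal with
      |- minus zero (plus (mult ?a ?b) (mult ?c ?d)) = ?e =>
        change (@eq R (0 - (a * b + c * d)) e)
      end.
      set (s := sqrt (1 - y ^ 2)) in *; rewrite <- H2; field; lra.
  - intros y Hy. replace (2 * N + 2)%nat with (S (2 * N + 1)) by lia.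
    evar_last; [apply is_derive_monomial|].
    rewrite plus_INR, mult_INR; simpl (INR 2); simpl (INR 1); ring.
  - intros y Hy; assert (Hy' : 0 <= y <= x) by lra.
    destruct (sqrt_ge_w y Hy') as [H1 H2].
    pose proof (inv_sqrt_coef_bounds N); pose proof (pos_INR N).
    assert (0 <= y ^ (2 * N + 1)) by (apply pow_le; lra).
    assert (0 < / sqrt (1 - y ^ 2) <= / w).
    { split; [apply Rinv_0_lt_compat|apply Rinv_le_contravar]; lra. }
    assert (0 <= (2 * INR N + 1) * inv_sqrt_coef N <= 2 * INR N + 2) by nra.
    unfold Rdiv; rewrite Rabs_pos_eq by (apply Rmult_le_pos; [apply Rmult_le_pos|]; lra).
    replace (/ w * (2 * INR N + 2) * y ^ (2 * N + 1))
      with ((2 * INR N + 2) * y ^ (2 * N + 1) * / w) by ring.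
    apply Rmult_le_compat; try lra; [apply Rmult_le_pos; lra|].
    apply Rmult_le_compat_r; lra.
Qed.

(** The derivative of [asin - asin_poly N] is the remainder of [1 / sqrt (1 - t^2)],
    that is, the quantity bounded in [inv_sqrt_remainder] divided by
    [sqrt (1 - t^2)]. *)
Lemma asin_remainder (N : nat) :
  Rabs (asin x - asin_poly N x) <= x ^ (2 * N + 2) / w ^ 2.
Proof.
  pose proof w_bounds as Hw.
  assert (Hk : 0 <= x ^ (2 * N + 2) / w ^ 2).
  { apply Rdiv_le_0_compat; [apply pow_le|apply pow_lt]; lra. }
  apply Rle_trans with (x ^ (2 * N + 2) / w ^ 2 * x); [|nra].
  apply (Rabs_le_of_derive
    (fun y => asin y - asin_poly N y)
    (fun y => / sqrt (1 - y ^ 2) - inv_sqrt_poly N y)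
    (fun y => x ^ (2 * N + 2) / w ^ 2 * y)
    (fun y => x ^ (2 * N + 2) / w ^ 2)).
  - lra.
  - replace (asin_poly N 0) with 0; [rewrite asin_0; ring|].
    unfold asin_poly; induction N as [|N IH]; cbn [sum_f_R0].
    + simpl; ring.
    + rewrite <- IH by (apply Rdiv_le_0_compat; [apply pow_le|apply pow_lt]; lra).
      rewrite pow_i by lia; ring.
  - ring.
  - intros t Ht; apply (is_derive_minus (V := R_NormedModule)).
    + apply is_derive_asin; lra.
    + apply is_derive_asin_poly.
  - intros t Ht; auto_derive; [easy|apply Rmult_1_r].
  - intros t Ht; destruct (sqrt_ge_w t Ht) as [H1 H2].
    replace (/ sqrt (1 - t ^ 2) - inv_sqrt_poly N t)
      with ((1 - sqrt (1 - t ^ 2) * inv_sqrt_poly N t) * / sqrt (1 - t ^ 2))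
      by (field; lra).
    assert (0 < / sqrt (1 - t ^ 2) <= / w).
    { split; [apply Rinv_0_lt_compat|apply Rinv_le_contravar]; lra. }
    rewrite Rabs_mult, (Rabs_pos_eq (/ _)) by lra.
    replace (x ^ (2 * N + 2) / w ^ 2) with (/ w * x ^ (2 * N + 2) * / w)
      by (field; lra).
    apply Rmult_le_compat; try lra; [apply Rabs_pos|].
    apply Rle_trans with (/ w * t ^ (2 * N + 2)); [now apply inv_sqrt_remainder|].
    apply Rmult_le_compat_l; [lra|]. apply pow_incr; lra.
Qed.

(** Here the remainder is divided by [sqrt (1 - x^2)] to obtain a function,
    [asin - G / sqrt (1 - x^2)] with [G] the partial sum, whose derivative is a
    single monomial divided by [sqrt (1 - x^2) ^ 3]. *)
Lemma sqrt_asin_remainder (k : nat) :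
  Rabs (sqrt (1 - x ^ 2) * asin x - sqrt_asin_poly (S k) x)
    <= x ^ (2 * k + 4) / w ^ 2.
Proof.
  pose proof w_bounds as Hw; pose proof (pos_INR k) as Hk.
  enough (HV : Rabs (asin x - sqrt_asin_poly (S k) x / sqrt (1 - x ^ 2))
               <= / w ^ 3 * x ^ S (2 * k + 4)).
  { replace (sqrt (1 - x ^ 2) * asin x - sqrt_asin_poly (S k) x)
      with (w * (asin x - sqrt_asin_poly (S k) x / sqrt (1 - x ^ 2)))
      by (unfold w; field; fold w; lra).
    rewrite Rabs_mult, (Rabs_pos_eq w) by lra.
    apply Rle_trans with (w * (/ w ^ 3 * x ^ S (2 * k + 4))).
    - apply Rmult_le_compat_l; lra.
    - rewrite <- (tech_pow_Rmult x).
      replace (w * (/ w ^ 3 * (x * x ^ (2 * k + 4))))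
        with (x ^ (2 * k + 4) / w ^ 2 * x) by (field; lra).
      assert (0 <= x ^ (2 * k + 4) / w ^ 2)
        by (apply Rdiv_le_0_compat; [apply pow_le|apply pow_lt]; lra).
      nra. }
  apply (Rabs_le_of_derive
    (fun y => asin y - sqrt_asin_poly (S k) y / sqrt (1 - y ^ 2))
    (fun y => - ((2 * INR k + 2) * sqrt_asin_coef (S k) * y ^ (2 * k + 4)
                 * / sqrt (1 - y ^ 2) ^ 3))
    (fun y => / w ^ 3 * y ^ S (2 * k + 4))
    (fun y => / w ^ 3 * (INR (2 * k + 4) + 1) * y ^ (2 * k + 4))).
  - lra.
  - replace (sqrt_asin_poly (S k) 0) with 0; [rewrite asin_0; unfold Rdiv; ring|].
    unfold sqrt_asin_poly; clear; induction (S k) as [|m IH]; cbn [sum_f_R0].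
    + simpl; ring.
    + rewrite pow_i by lia; lra.
  - rewrite pow_i by lia; ring.
  - intros y Hy; destruct (sqrt_ge_w y Hy) as [H1 H2].
    evar_last.
    + apply (is_derive_minus (V := R_NormedModule)).
      * apply is_derive_asin; lra.
      * apply is_derive_div.
        -- apply is_derive_sqrt_asin_poly; nra.
        -- apply is_derive_sqrt_one_minus_sq; exact Hy.
        -- lra.
    + match goal with |- minus ?a ?b = ?c => change (@eq R (Rminus a b) c) end.
      set (s := sqrt (1 - y ^ 2)) in *; rewrite <- !H2; field; lra.
  - intros y Hy; apply is_derive_monomial.
  - intros y Hy; destruct (sqrt_ge_w y Hy) as [H1 H2].
    pose proof (sqrt_asin_coef_bounds k).
    assert (0 <= y ^ (2 * k + 4)) by (apply pow_le; lra).
    assert (0 < / sqrt (1 - y ^ 2) ^ 3 <= / w ^ 3).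
    { split; [apply Rinv_0_lt_compat, pow_lt; lra|].
      apply Rinv_le_contravar; [apply pow_lt|apply pow_incr]; lra. }
    rewrite plus_INR, mult_INR; simpl (INR 2); simpl (INR 4).
    assert (0 <= (2 * INR k + 2) * sqrt_asin_coef (S k)) by nra.
    rewrite Rabs_Ropp, Rabs_pos_eq by (apply Rmult_le_pos; [apply Rmult_le_pos|]; lra).
    match goal with |- _ <= ?a * ?b * ?c => replace (a * b * c) with (b * c * a) by ring end.
    apply Rmult_le_compat; try lra; [apply Rmult_le_pos; lra|].
    apply Rmult_le_compat_r; nra.
Qed.

End Remainders.

(** * Convergence of the partial sums *)

Lemma partial_sum_S (x : R) (N : nat) : (1 <= N)%nat ->
  partial_sum x (S N) = partial_sum x N + E (S N) * x ^ (2 * S N + 1).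
Proof. intros HN; unfold partial_sum; now rewrite sum_n_Sm by lia. Qed.

Lemma partial_sum_decomp (x : R) (k : nat) :
  partial_sum x (S k) = 2 * asin_poly (S k) x + sqrt_asin_poly (S k) x - 3 * x.
Proof.
  induction k as [|k IH].
  - unfold partial_sum; rewrite sum_n_m_zero by lia.
    unfold asin_poly, sqrt_asin_poly; cbn [sum_f_R0].
    rewrite sqrt_asin_coef_0, sqrt_asin_coef_1, inv_sqrt_coef_0.
    unfold inv_sqrt_coef, zero; simpl; field.
  - rewrite partial_sum_S by lia.
    rewrite IH, E_coef; unfold asin_poly, sqrt_asin_poly.
    rewrite !(tech5 _ (S k)); ring.
Qed.

Lemma is_lim_seq_partial_sum (x : R) : 0 < x < 1 ->
  is_lim_seq (fun k => partial_sum x (S k))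
    ((2 + sqrt (1 - x ^ 2)) * asin x - 3 * x).
Proof.
  intros Hx; pose proof (w_bounds x Hx) as Hw; cbv zeta in Hw.
  set (f := (2 + sqrt (1 - x ^ 2)) * asin x - 3 * x).
  set (C := 3 / sqrt (1 - x ^ 2) ^ 2).
  assert (HC : 0 <= C) by (apply Rdiv_le_0_compat; [|apply pow_lt]; lra).
  assert (Herr : forall k, Rabs (partial_sum x (S k) - f) <= C * (x ^ 2) ^ k).
  { intros k; rewrite partial_sum_decomp.
    replace (2 * asin_poly (S k) x + sqrt_asin_poly (S k) x - 3 * x - f)
      with (- (2 * (asin x - asin_poly (S k) x)
             + (sqrt (1 - x ^ 2) * asin x - sqrt_asin_poly (S k) x)))
      by (unfold f; ring).
    rewrite Rabs_Ropp.
    eapply Rle_trans; [apply Rabs_triang|].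
    rewrite Rabs_mult, (Rabs_pos_eq 2) by lra.
    pose proof (asin_remainder x Hx (S k)) as H1.
    pose proof (sqrt_asin_remainder x Hx k) as H2.
    replace (2 * S k + 2)%nat with (2 * k + 4)%nat in H1 by lia.
    rewrite pow_add, pow_mult in H1, H2.
    assert (Hq : 0 <= (x ^ 2) ^ k) by (apply pow_le; nra).
    assert (Hx4 : x ^ 4 <= 1) by (rewrite <- (pow1 4); apply pow_incr; lra).
    assert (H3 : (x ^ 2) ^ k * x ^ 4 / sqrt (1 - x ^ 2) ^ 2
                 <= (x ^ 2) ^ k / sqrt (1 - x ^ 2) ^ 2).
    { apply Rmult_le_compat_r; [|nra].
      apply Rlt_le, Rinv_0_lt_compat, pow_lt; lra. }
    replace (C * (x ^ 2) ^ k) with (3 * ((x ^ 2) ^ k / sqrt (1 - x ^ 2) ^ 2))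
      by (unfold C, Rdiv; ring).
    lra. }
  assert (Hgeom : is_lim_seq (fun k => C * (x ^ 2) ^ k) 0).
  { replace (Finite 0) with (Rbar_mult C 0) by (simpl; f_equal; ring).
    apply is_lim_seq_scal_l, is_lim_seq_geom.
    rewrite Rabs_pos_eq; nra. }
  apply (is_lim_seq_le_le (fun k => f - C * (x ^ 2) ^ k) _
                          (fun k => f + C * (x ^ 2) ^ k)).
  - intros k; specialize (Herr k); apply Rcomplements.Rabs_le_between in Herr; lra.
  - replace (Finite f) with (Finite (f - 0)) by (f_equal; ring).
    apply is_lim_seq_minus'; [apply is_lim_seq_const|exact Hgeom].
  - replace (Finite f) with (Finite (f + 0)) by (f_equal; ring).
    apply is_lim_seq_plus'; [apply is_lim_seq_const|exact Hgeom].
Qed.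

(** * The two bounds *)

Lemma partial_sum_lt (x : R) (m : nat) : 0 < x < 1 -> (1 <= m)%nat ->
  partial_sum x m < (2 + sqrt (1 - x ^ 2)) * asin x - 3 * x.
Proof.
  intros Hx Hm.
  assert (Hincr : forall N, (1 <= N)%nat -> partial_sum x N < partial_sum x (S N)).
  { intros N HN; rewrite partial_sum_S by lia.
    assert (0 < E (S N) * x ^ (2 * S N + 1)); [|lra].
    apply Rmult_lt_0_compat; [apply E_pos; lia|apply pow_lt; lra]. }
  apply Rlt_le_trans with (partial_sum x (S m)); [now apply Hincr|].
  apply (is_lim_seq_incr_compare _ _ (is_lim_seq_partial_sum x Hx)).
  intros k; apply Rlt_le, Hincr; lia.
Qed.

(** [asin y <= PI / 2] gives [partial_sum y m <= (2 + sqrt (1 - y^2)) * (PI / 2) - 3 * y]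
    for [0 < y < 1]; both sides are continuous at [1]. *)
Lemma partial_sum_at_1_le (m : nat) : (1 <= m)%nat -> partial_sum 1 m <= PI - 3.
Proof.
  intros Hm.
  set (g := fun y => (2 + sqrt (1 - y ^ 2)) * (PI / 2) - 3 * y - partial_sum y m).
  assert (Hc : continuity_pt g 1).
  { apply continuity_pt_minus; [apply continuity_pt_minus; [apply continuity_pt_mult|]|].
    - apply continuity_pt_plus; [apply continuity_pt_const; now intros ??|].
      apply (continuity_pt_comp (fun y => 1 - y ^ 2) sqrt); [reg|].
      apply continuity_pt_sqrt; lra.
    - apply continuity_pt_const; now intros ??.
    - reg.
    - clear g; induction Hm as [|m Hm IH].
      + apply continuity_pt_const; intros y z; unfold partial_sum.
        now rewrite !sum_n_m_zero by lia.
      + apply (continuity_pt_ext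
                 (fun y => partial_sum y m + E (S m) * y ^ (2 * S m + 1))).
        * intros y; now rewrite partial_sum_S by lia.
        * apply continuity_pt_plus; [exact IH|].
          apply continuity_pt_mult; [apply continuity_pt_const; now intros ??|].
          apply derivable_continuous_pt, derivable_pt_pow. }
  assert (Hinv : is_lim_seq (fun k => 1 - / (INR k + 2)) 1).
  { replace (Finite 1) with (Finite (1 - 0)) by (f_equal; ring).
    apply is_lim_seq_minus'; [apply is_lim_seq_const|].
    apply (is_lim_seq_inv _ p_infty); [|easy].
    apply (is_lim_seq_plus _ _ p_infty 2);
      [apply is_lim_seq_INR|apply is_lim_seq_const|easy]. }
  assert (Hg := is_lim_seq_continuous g _ 1 Hc Hinv).
  assert (Hle : Rbar_le 0 (g 1)).
  { refine (is_lim_seq_le _ _ _ _ _ (is_lim_seq_const 0) Hg); intros k.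
    pose proof (pos_INR k).
    set (y := 1 - / (INR k + 2)).
    assert (Hy : 0 < y < 1).
    { assert (0 < / (INR k + 2)) by (apply Rinv_0_lt_compat; lra).
      assert (/ (INR k + 2) <= / 2) by (apply Rinv_le_contravar; lra).
      unfold y; lra. }
    pose proof (partial_sum_lt y m Hy Hm); pose proof (asin_bound y).
    pose proof (sqrt_pos (1 - y ^ 2)); unfold g; nra. }
  simpl in Hle; unfold g in Hle.
  replace (1 - 1 ^ 2) with 0 in Hle by ring; rewrite sqrt_0 in Hle; lra.
Qed.

(** Each increment of the left side is at most the corresponding increment of the
    right side because [x^(2N+3) <= x^(2m+3)]; the constant subtracted on the right
    is the gap between the two for the term of index [m + 2]. *)
Lemma tail_compare (x : R) (m N : nat) : 0 < x < 1 -> (1 <= m)%nat -> (m + 2 <= N)%nat ->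
  partial_sum x N <= partial_sum x m
    + (partial_sum 1 N - partial_sum 1 m) * x ^ (2 * m + 3)
    - E (m + 2) * (x ^ (2 * m + 3) - x ^ (2 * m + 5)).
Proof.
  intros Hx Hm; induction 1 as [|N HN IH].
  - replace (m + 2)%nat with (S (S m)) by lia.
    rewrite !partial_sum_S, !pow1 by lia.
    replace (2 * S m + 1)%nat with (2 * m + 3)%nat by lia.
    replace (2 * S (S m) + 1)%nat with (2 * m + 5)%nat by lia.
    apply Req_le; ring.
  - rewrite !partial_sum_S, !pow1 by lia.
    assert (HE : 0 < E (S N)) by (apply E_pos; lia).
    assert (Hp : x ^ (2 * S N + 1) <= x ^ (2 * m + 3)).
    { replace (2 * S N + 1)%nat with (2 * m + 3 + 2 * (N - m))%nat by lia.
      rewrite pow_add.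
      assert (x ^ (2 * (N - m)) <= 1)
        by (rewrite <- (pow1 (2 * (N - m))); apply pow_incr; lra).
      assert (0 < x ^ (2 * m + 3)) by (apply pow_lt; lra).
      nra. }
    nra.
Qed.

Theorem theorem12 (n : nat) (x : R) (hn : (2 <= n)%nat) (hx : 0 < x < 1) :
  sum_n_m (fun m : nat => E m * x ^ (2 * m + 1)) 2 n / (2 + sqrt (1 - x ^ 2))
    < asin x - 3 * x / (2 + sqrt (1 - x ^ 2))
  /\
  asin x - 3 * x / (2 + sqrt (1 - x ^ 2))
    < (sum_n_m (fun m : nat => E m * x ^ (2 * m + 1)) 2 (n - 1)
        + (PI - 3 - sum_n_m E 2 (n - 1)) * x ^ (2 * n + 1))
      / (2 + sqrt (1 - x ^ 2)).
Proof.
  pose proof (sqrt_pos (1 - x ^ 2)) as Hs.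
  replace (asin x - 3 * x / (2 + sqrt (1 - x ^ 2)))
    with (((2 + sqrt (1 - x ^ 2)) * asin x - 3 * x) / (2 + sqrt (1 - x ^ 2)))
    by (field; lra).
  assert (Hi : 0 < / (2 + sqrt (1 - x ^ 2))) by (apply Rinv_0_lt_compat; lra).
  split; apply Rmult_lt_compat_r; try exact Hi; fold (partial_sum x n).
  - apply partial_sum_lt; [exact hx|lia].
  - destruct n as [|m]; [lia|]; assert (Hm : (1 <= m)%nat) by lia.
    replace (S m - 1)%nat with m by lia.
    replace (2 * S m + 1)%nat with (2 * m + 3)%nat by lia.
    fold (partial_sum x m).
    replace (sum_n_m E 2 m) with (partial_sum 1 m)
      by (apply sum_n_m_ext; intros i; rewrite pow1; apply Rmult_1_r).
    set (gap := E (m + 2) * (x ^ (2 * m + 3) - x ^ (2 * m + 5))).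
    assert (Hgap : 0 < gap).
    { apply Rmult_lt_0_compat; [apply E_pos; lia|].
      replace (2 * m + 5)%nat with (2 + (2 * m + 3))%nat by lia.
      rewrite (pow_add x 2 (2 * m + 3)).
      assert (0 < x ^ (2 * m + 3)) by (apply pow_lt; lra).
      assert (x ^ 2 < 1) by nra.
      nra. }
    assert (Hp : 0 < x ^ (2 * m + 3)) by (apply pow_lt; lra).
    apply Rle_lt_trans with
      (partial_sum x m + (PI - 3 - partial_sum 1 m) * x ^ (2 * m + 3) - gap); [|lra].
    refine (is_lim_seq_le_loc _ _ _ _ _ (is_lim_seq_partial_sum x hx)
              (is_lim_seq_const _)).
    exists (m + 1)%nat; intros k Hk.
    pose proof (tail_compare x m (S k) hx Hm ltac:(lia)) as Ht; fold gap in Ht.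
    pose proof (partial_sum_at_1_le (S k) ltac:(lia)); nra.
Qed.
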